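(* Let $\mathbb A$ be a linear subspace of $\mathbb R^{m_1\times m_2}$, let $\lambda>0$, and let $\hat A^\lambda\in\mathbb A$ be a minimizer over $A\in\mathbb A$ of $$L_n(A)=\|A\|_{L_2(\Pi)}^2-\Big\langle \tfrac2n\sum_{i=1}^n Y_iX_i,\,A\Big\rangle+\lambda\|A\|_1 .$$ Let $\mathbf M=\frac1n\sum_{i=1}^n\big(Y_iX_i-\mathbb E(Y_iX_i)\big)$. If $\lambda\ge3\|\mathbf M\|_\infty$, then $$\|\hat A^\lambda-A_0\|_{L_2(\Pi)}^2\le\inf_{A\in\mathbb A}\Big[\|A-A_0\|_{L_2(\Pi)}^2+\lambda^2\mu^2(A)\,\mathrm{rank}(A)\Big].$$ (The inequality holds for every realization of the data for which $\lambda\ge3\|\mathbf M\|_\infty$.)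
   Context: Trace regression model: $(X_i,Y_i)$, $i=1,\dots,n$, are independent random pairs, $X_i$ a random matrix in $\mathbb R^{m_1\times m_2}$ and $Y_i$ a real random variable, with $\mathbb E(Y_i\mid X_i)=\mathrm{tr}(X_i^\top A_0)$ for an unknown matrix $A_0\in\mathbb R^{m_1\times m_2}$. All expectations that appear are assumed to exist and be finite. Notation: $\langle A,B\rangle=\mathrm{tr}(A^\top B)$; $\|A\|_{L_2(\Pi)}^2=\frac1n\sum_{i=1}^n\mathbb E\langle A,X_i\rangle^2$. $\|A\|_1$, $\|A\|_2$, $\|A\|_\infty$ denote the nuclear, Frobenius and operator norms. If $A=\sum_{j=1}^r\sigma_ju_jv_j^\top$ is a singular value decomposition with $r=\mathrm{rank}(A)$ and $\sigma_j>0$, the support of $A$ is $(S_1,S_2)$ with $S_1=\mathrm{span}\{u_j\}$, $S_2=\mathrm{span}\{v_j\}$; $P_S$ is the orthogonal projector onto $S$. For $A\in\mathbb A$ with support $(S_1,S_2)$ and $B\in\mathbb R^{m_1\times m_2}$ set $$\mathcal P_A^\perp(B)=P_{S_1^\perp}BP_{S_2^\perp},\qquad \mathcal P_A(B)=B-P_{S_1^\perp}BP_{S_2^\perp}.$$ For $c_0\ge0$ let $\mathbb C_{A,c_0}=\{B\in\mathbb A:\|\mathcal P_A^\perp(B)\|_1\le c_0\|\mathcal P_A(B)\|_1\}$ and $$\mu_{c_0}(A)=\inf\{\mu'>0:\ \|\mathcal P_A(B)\|_2\le\mu'\|B\|_{L_2(\Pi)}\ \ \forall B\in\mathbb C_{A,c_0}\}$$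 (with $\inf\emptyset=+\infty$). Finally $\mu(A):=\mu_5(A)$. *)

(* Defs.v *)
From HB Require Import structures.
From mathcomp Require Import all_boot all_order all_algebra.
From mathcomp Require Import all_classical all_reals all_analysis.
From mathcomp Require complex sesquilinear spectral.

Set Implicit Arguments.
Unset Strict Implicit.
Unset Printing Implicit Defensive.
Import Order.TTheory GRing.Theory Num.Theory.

Local Open Scope classical_set_scope.
Local Open Scope ring_scope.

Module SymEigen.
Import complex sesquilinear spectral.

Lemma sym_eigenvalue (R : rcfType) n (B : 'M[R]_n) : B^T = B -> B != 0 ->
  exists2 a, a != 0 & eigenvalue B a.
Proof.
move=> Bsym B0.
pose C : 'M[complex.complex R]_n := map_mx (real_complex R) B.
have hC : C \is hermsymmx.
  apply: realsym_hermsym; last first.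
    by apply/mxOverP => i j; rewrite mxE complex_real.
  by apply/is_hermitianmxP; rewrite expr0 scale1r map_mx_id // map_trmx Bsym.
have /orthomx_spectralP Ceq := hermitian_normalmx hC.
have dreal := hermitian_spectral_diag_real hC.
have Pu := spectral_unit C.
move: Ceq dreal Pu; set d := spectral_diag C; set P := spectralmx C => Ceq dreal Pu.
have [d0|[j dj]] : d = 0 \/ exists j, d 0 j != 0.
  case: (pickP (fun j => d 0 j != 0)) => [j dj|d0]; [by right; exists j|left].
  by apply/rowP => j; rewrite mxE; apply/eqP; have := d0 j => /negbFE.
  move: Ceq; rewrite d0 [diag_mx 0](_ : _ = 0); last first.
    by apply/matrixP => i j; rewrite !mxE mul0rn.
  rewrite mulmx0 mul0mx => /matrixP C0; case/negP: B0; apply/eqP/matrixP => i j.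
  by have := C0 i j; rewrite !mxE => -[].
have /mxOverP/(_ 0 j)/complex_realP[a da] := dreal.
exists a; first by apply: contra dj => /eqP a0; rewrite da a0.
have : eigenvalue C (d 0 j); last by rewrite da eigenvalue_map.
apply/eigenvalueP; exists (row j P).
  rewrite -row_mul {1}Ceq -mulmxA mulKVmx //; apply/rowP => k.
  by rewrite mul_diag_mx !mxE.
apply: contraTneq Pu => Pj0; rewrite -row_free_unit; apply/row_freePn.
by exists j; rewrite Pj0 sub0mx.
Qed.

End SymEigen.

Section SVD.
Context {R : realType}.

(* The vectors u_j, v_j are the rows of [svd_left], [svd_right], so that the
   row spaces of these two matrices are span {u_j} and span {v_j}. *)
Record svd_data r m n := SvdData {
  svd_left : 'M[R]_(r, m);
  svd_values : 'rV[R]_r;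
  svd_right : 'M[R]_(r, n) }.

Definition is_svd r m n (A : 'M[R]_(m, n)) (D : svd_data r m n) : Prop :=
  [/\ svd_left D *m (svd_left D)^T = 1%:M,
      svd_right D *m (svd_right D)^T = 1%:M,
      forall j, 0 < svd_values D 0 j &
      A = \sum_j svd_values D 0 j *:
            ((row j (svd_left D))^T *m row j (svd_right D))].

Lemma svd_sumE r m n (D : svd_data r m n) :
  \sum_j svd_values D 0 j *: ((row j (svd_left D))^T *m row j (svd_right D))
  = (svd_left D)^T *m diag_mx (svd_values D) *m svd_right D.
Proof.
apply/matrixP => i k; rewrite summxE !mxE; apply: eq_bigr => j _.
by rewrite mul_mx_diag !mxE big_ord1 !mxE mulrA [_ * svd_left D j i]mulrC.
Qed.

Lemma row_norm_gt0 n (v : 'rV[R]_n) : v != 0 -> 0 < (v *m v^T) 0 0.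
Proof.
have -> : (v *m v^T) 0 0 = \sum_j v 0 j ^+ 2.
  by rewrite !mxE; apply: eq_bigr => j _; rewrite !mxE expr2.
move=> v0; rewrite lt_neqAle sumr_ge0 ?andbT => [|j _]; last exact: sqr_ge0.
apply: contra v0; rewrite eq_sym psumr_eq0 => [|j _]; last exact: sqr_ge0.
move=> /allP v0; apply/eqP/rowP => j; rewrite mxE.
by have := v0 j (mem_index_enum j); rewrite sqrf_eq0 => /eqP.
Qed.

Lemma svd_rank r m n (A : 'M[R]_(m, n)) (D : svd_data r m n) :
  is_svd A D -> r = \rank A.
Proof.
move=> [UU VV D0]; rewrite svd_sumE => ->.
have fr p (W : 'M[R]_(r, p)) : W *m W^T = 1%:M -> row_free W.
  by move=> WW; apply/row_freeP; exists W^T.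
rewrite mxrankMfree ?fr // mxrankMfree ?mxrank_tr; first by apply/esym/eqP/fr.
rewrite row_free_unit unitmxE det_diag unitfE.
by apply/prodf_neq0 => j _; rewrite gt_eqF.
Qed.

Lemma svd_peel m n (A : 'M[R]_(m, n)) : A != 0 ->
  exists (s : R) (u : 'rV[R]_m) (v : 'rV[R]_n), [/\ 0 < s, u *m u^T = 1%:M,
    v *m v^T = 1%:M, u *m A = s *: v & v *m A^T = s *: u].
Proof.
move=> A0; have B0 : A^T *m A != 0.
  apply: contra A0 => /eqP/matrixP AA0; apply/eqP/trmx_inj; rewrite trmx0.
  apply/row_matrixP => i; rewrite row0; apply/eqP/negPn/negP => /row_norm_gt0.
  suff -> : (row i A^T *m (row i A^T)^T) 0 0 = (A^T *m A) i i.
    by rewrite AA0 mxE ltxx.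
  by rewrite !mxE; apply: eq_bigr => j _; rewrite !mxE.
have [|a a0 /eigenvalueP[w wB w0]] := SymEigen.sym_eigenvalue _ B0.
  by rewrite trmx_mul trmxK.
have w_gt0 := row_norm_gt0 w0.
set q := (w *m w^T) 0 0 in w_gt0.
have qE : w *m w^T = q%:M by apply: mx11_scalar.
have aq : ((w *m A^T) *m (w *m A^T)^T) = (a * q)%:M.
  by rewrite trmx_mul trmxK !mulmxA -(mulmxA w) wB -scalemxAl qE scale_scalar_mx.
have wA0 : w *m A^T != 0.
  apply: contra_neq (mulf_neq0 a0 (lt0r_neq0 w_gt0)) => wA0.
  by move: aq; rewrite wA0 mul0mx => /matrixP/(_ 0 0); rewrite !mxE mulr1n.
have a_gt0 : 0 < a.
  by have := row_norm_gt0 wA0; rewrite aq mxE mulr1n pmulr_lgt0.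
pose s := Num.sqrt a; pose p := Num.sqrt q.
have s_gt0 : 0 < s by rewrite sqrtr_gt0.
have p_gt0 : 0 < p by rewrite sqrtr_gt0.
have ss : a = s ^+ 2 by rewrite sqr_sqrtr // ltW.
have pp : q = p ^+ 2 by rewrite sqr_sqrtr // ltW.
have s0 := lt0r_neq0 s_gt0; have p0 := lt0r_neq0 p_gt0.
exists s, ((s * p)^-1 *: (w *m A^T)), (p^-1 *: w); split => //.
- rewrite linearZ /= -scalemxAl -scalemxAr aq scalerA scale_scalar_mx ss pp.
  by congr (_%:M); rewrite -expr2 -exprMn exprVn mulVf // sqrf_eq0 mulf_neq0.
- rewrite linearZ /= -scalemxAl -scalemxAr qE scalerA scale_scalar_mx pp.
  by congr (_%:M); rewrite -expr2 exprVn mulVf // sqrf_eq0.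
- rewrite -scalemxAl -mulmxA wB !scalerA ss; congr (_ *: _).
  by rewrite invfM expr2 mulrAC mulrA mulVf // mul1r.
- rewrite -scalemxAl scalerA; congr (_ *: _).
  by rewrite invfM mulrA mulfV // mul1r.
Qed.

Lemma svd_exists_rank k m n (A : 'M[R]_(m, n)) : (\rank A <= k)%N ->
  exists r (D : svd_data r m n), is_svd A D.
Proof.
elim: k A => [|k IH] A rA; have [A0|A0] := eqVneq A 0.
1,3: exists 0%N, (SvdData 0 0 0); split; rewrite ?big_ord0 //=;
  [by rewrite flatmx0 [RHS]flatmx0|by rewrite flatmx0 [RHS]flatmx0|by case].
  by move: rA; rewrite leqn0 mxrank_eq0 (negPf A0).
have [s [u [v [s_gt0 uu vv uA vA]]]] := svd_peel A0.
have s0 := lt0r_neq0 s_gt0.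
pose A' := A - s *: (u^T *m v).
have uA' : u *m A' = 0.
  by rewrite mulmxBr -scalemxAr mulmxA uu mul1mx uA subrr.
have vA' : A' *m v^T = 0.
  apply/trmx_inj; rewrite trmx0 trmx_mul trmxK linearB linearZ /= trmx_mul trmxK.
  by rewrite mulmxBr -scalemxAr mulmxA vv mul1mx vA subrr.
have A'A : (A' <= A)%MS.
  rewrite addmx_sub ?submx_refl // eqmx_opp scalemx_sub //.
  rewrite (submx_trans (submxMl _ _)) //.
  by rewrite -[v](scalerK s0) -uA scalemx_sub ?submxMl.
have [|r [[U d V] [/= UU VV d0 eA']]] := IH A'.
  rewrite -ltnS (leq_trans _ rA) // ltn_neqAle mxrankS // andbT.
  apply/negP; rewrite (mxrank_leqif_sup A'A) => /submxP[W AW].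
  have /eqP : A *m v^T = 0 by rewrite AW -mulmxA vA' mulmx0.
  rewrite -trmx_eq0 trmx_mul trmxK vA scaler_eq0 (negPf s0) /= => /eqP u0.
  by move: uu; rewrite u0 mul0mx => /matrixP/(_ 0 0)/eqP; rewrite !mxE eq_sym oner_eq0.
rewrite (svd_sumE (SvdData U d V)) /= in eA'.
have du : diag_mx d \in unitmx.
  by rewrite unitmxE det_diag unitfE; apply/prodf_neq0 => j _; rewrite gt_eqF.
have uU : u *m U^T = 0.
  apply: (can_inj (mulmxK du)); rewrite mul0mx -[RHS](mul0mx _ V^T) -uA' eA'.
  by rewrite !mulmxA -(mulmxA _ V) VV mulmx1.
have Vv : V *m v^T = 0.
  apply: (can_inj (mulKmx du)); rewrite mulmx0 -[RHS](mulmx0 _ U) -vA' eA'.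
  by rewrite !mulmxA UU mul1mx.
have Uu : U *m u^T = 0 by apply/trmx_inj; rewrite trmx_mul trmxK uU trmx0.
have vV : v *m V^T = 0 by apply/trmx_inj; rewrite trmx_mul trmxK Vv trmx0.
exists (1 + r)%N, (SvdData (col_mx u U) (row_mx s%:M d) (col_mx v V)); split.
- by rewrite /= tr_col_mx mul_col_row uu UU uU Uu -scalar_mx_block.
- by rewrite /= tr_col_mx mul_col_row vv VV vV Vv -scalar_mx_block.
- by move=> j; rewrite /= mxE; case: split_ordP => i _; rewrite ?ord1 ?mxE ?mulr1n.
- rewrite svd_sumE /= tr_col_mx diag_mx_row mul_row_block mul_row_col.
  rewrite !mulmx0 addr0 add0r -eA' /A' [diag_mx _](_ : _ = s%:M).
    by rewrite mul_mx_scalar -scalemxAl addrC subrK.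
  by apply/matrixP => i j; rewrite !mxE !ord1.
Qed.

Lemma svd_exists m n (A : 'M[R]_(m, n)) :
  exists D : svd_data (\rank A) m n, is_svd A D.
Proof.
have [r [D svdA]] := svd_exists_rank (leqnn (\rank A)).
by have rE := svd_rank svdA; case: _ / rE in D svdA *; exists D.
Qed.

Definition svd m n (A : 'M[R]_(m, n)) : svd_data (\rank A) m n :=
  sval (cid (svd_exists A)).

Lemma svdP m n (A : 'M[R]_(m, n)) : is_svd A (svd A).
Proof. exact: (svalP (cid (svd_exists A))). Qed.

End SVD.

Section MatrixNorms.
Context {R : realType}.

Definition mxinner m n (A B : 'M[R]_(m, n)) : R := \tr (A^T *m B).

Definition nuclear_norm m n (A : 'M[R]_(m, n)) : R :=
  \sum_j svd_values (svd A) 0 j.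

Definition frobenius_norm m n (A : 'M[R]_(m, n)) : R :=
  Num.sqrt (mxinner A A).

Definition operator_norm m n (A : 'M[R]_(m, n)) : R :=
  sup [set frobenius_norm (A *m x) |
       x in [set x : 'cV[R]_n | frobenius_norm x <= 1]].

(* Subspaces of R^n are represented by row spaces of matrices with n columns. *)
Definition orthogonal_compl p n (S : 'M[R]_(p, n)) : 'M[R]_n := kermx S^T.

(* [proj_mx] acts on row vectors; an orthogonal projector is symmetric, so the
   same matrix also projects column vectors by multiplication on the left. *)
Definition orthogonal_proj p n (S : 'M[R]_(p, n)) : 'M[R]_n :=
  proj_mx <<S>>%MS (orthogonal_compl S).

Definition support1 m n (A : 'M[R]_(m, n)) : 'M[R]_(\rank A, m) :=
  svd_left (svd A).

Definition support2 m n (A : 'M[R]_(m, n)) : 'M[R]_(\rank A, n) :=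
  svd_right (svd A).

Definition proj_off_support m n (A B : 'M[R]_(m, n)) : 'M[R]_(m, n) :=
  orthogonal_proj (orthogonal_compl (support1 A)) *m B
  *m orthogonal_proj (orthogonal_compl (support2 A)).

Definition proj_on_support m n (A B : 'M[R]_(m, n)) : 'M[R]_(m, n) :=
  B - proj_off_support A B.

End MatrixNorms.

Section Probability.
Context {d : measure_display} {T : measurableType d} {R : realType}.
Variable P : probability T R.

Definition sigma_matrix m n (X : T -> 'M[R]_(m, n)) : set_system T :=
  <<s \bigcup_(p in [set: 'I_m * 'I_n])
        preimage_set_system setT (fun w => X w p.1 p.2) measurable >>.

Definition sigma_pair m n (X : T -> 'M[R]_(m, n)) (Y : T -> R) :
    set_system T :=
  <<s sigma_matrix X `|` preimage_set_system setT Y measurable >>.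

Definition mutually_independent n (F : 'I_n -> set_system T) : Prop :=
  forall (J : {set 'I_n}) (E : 'I_n -> set T),
    (forall i, i \in J -> F i (E i)) ->
    P (\bigcap_(i in [set` J]) E i) = (\prod_(i in J) P (E i))%E.

(* [Z] is a version of the conditional expectation of [Y] given [F]. *)
Definition is_cond_expectation (F : set_system T) (Y Z : T -> R) : Prop :=
  [/\ P.-integrable setT (EFin \o Y),
      P.-integrable setT (EFin \o Z),
      forall B, measurable B -> F (Z @^-1` B) &
      forall E, F E ->
        (\int[P]_(w in E) (Y w)%:E = \int[P]_(w in E) (Z w)%:E)%E].

End Probability.

Section TraceRegression.
Context {d : measure_display} {T : measurableType d} {R : realType}.
Variables (P : probability T R) (n m1 m2 : nat).
Variables (X : 'I_n -> T -> 'M[R]_(m1, m2)) (Y : 'I_n -> T -> R).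

Record trace_regression (A0 : 'M[R]_(m1, m2)) : Prop := {
  design_measurable : forall i j k, measurable_fun setT (fun w => X i w j k);
  response_measurable : forall i, measurable_fun setT (Y i);
  sample_independent :
    mutually_independent P (fun i => sigma_pair (X i) (Y i));
  cond_mean : forall i,
    is_cond_expectation P (sigma_matrix (X i)) (Y i)
      (fun w => \tr ((X i w)^T *m A0));
  design_square_integrable : forall i A,
    P.-integrable setT (fun w => (mxinner A (X i w) ^+ 2)%:E);
  product_integrable : forall i j k,
    P.-integrable setT (fun w => (Y i w * X i w j k)%:E) }.

Definition L2Pi_norm (A : 'M[R]_(m1, m2)) : R :=
  Num.sqrt (n%:R^-1 * \sum_i fine 'E_P[fun w => mxinner A (X i w) ^+ 2]).

Definition penalized_risk (lambda : R) (w : T) (A : 'M[R]_(m1, m2)) : R :=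
  L2Pi_norm A ^+ 2
  - mxinner ((2 / n%:R) *: \sum_i Y i w *: X i w) A
  + lambda * nuclear_norm A.

Definition noise_matrix (w : T) : 'M[R]_(m1, m2) :=
  n%:R^-1 *: \sum_i (Y i w *: X i w
    - \matrix_(j, k) fine 'E_P[fun w' => Y i w' * X i w' j k]).

Variable AA : {vspace 'M[R]_(m1, m2)}.

Definition cone (c0 : R) (A : 'M[R]_(m1, m2)) : set 'M[R]_(m1, m2) :=
  [set B | B \in AA /\ nuclear_norm (proj_off_support A B)
                       <= c0 * nuclear_norm (proj_on_support A B)].

Definition mu_at (c0 : R) (A : 'M[R]_(m1, m2)) : \bar R :=
  ereal_inf [set t%:E | t in [set t : R | 0 < t /\
    forall B, cone c0 A B ->
      frobenius_norm (proj_on_support A B) <= t * L2Pi_norm B]].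

Definition mu (A : 'M[R]_(m1, m2)) : \bar R := mu_at 5 A.

End TraceRegression.

(* Main.v *)
Require Import Defs.
From mathcomp Require Import all_boot all_order all_algebra.
From mathcomp Require Import all_classical all_reals all_analysis.
From mathcomp Require Import measurable_realfun ring lra.
Import Order.TTheory GRing.Theory Num.Theory.
Local Open Scope classical_set_scope.
Local Open Scope ring_scope.

(* The minimizer satisfies the first-order inequality 2 <Ahat - A0, Ahat - A>
   <= 2 <M, Ahat - A> + lambda (|A|_1 - |Ahat|_1) in L_2(Pi); the conditional
   mean assumption turns the linear term of the risk into
   <A0, .>_(L_2(Pi)) + <M, .>.  Write A = sum_j sigma_j u_j v_j^T, S = sum_j
   u_j v_j^T and B = Ahat - A.  The nuclear norm is dual to the operator norm,
   and S + P_A^perp(W) is a contraction whenever W is, so |A + B|_1 >= |A|_1 +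
   <S, B> + |P_A^perp(B)|_1.  Hence
     |Ahat - A0|^2 + |B|^2 <= |A - A0|^2 + 2 <M, B> - lambda <S, B>
                              - lambda |P_A^perp(B)|_1.
   With |M|_oo <= lambda / 3 and trace duality this puts B in the cone with
   c_0 = 5 unless |Ahat - A0| <= |A - A0|.  Bounding instead <S, B> and <M, B>
   by Cauchy-Schwarz, with |S|_2 = sqrt(rank A) and |P_A(M)|_2 <=
   sqrt(2 rank A) |M|_oo, leaves lambda (1 + 2 sqrt 2 / 3) sqrt(rank A)
   |P_A(B)|_2 <= 2 lambda sqrt(rank A) mu(A) |B|, which AM-GM absorbs. *)

Set Implicit Arguments.
Unset Strict Implicit.
Unset Printing Implicit Defensive.

(** * The Frobenius inner product and operator-norm bounds *)

Section FrobeniusInner.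
Context {R : realType}.

Lemma mxinnerE m n (A B : 'M[R]_(m, n)) :
  mxinner A B = \sum_i \sum_j A i j * B i j.
Proof.
rewrite /mxinner /mxtrace exchange_big; apply: eq_bigr => j _ /=.
by rewrite !mxE; apply: eq_bigr => i _; rewrite !mxE.
Qed.

Lemma mxinnerC m n (A B : 'M[R]_(m, n)) : mxinner A B = mxinner B A.
Proof. by rewrite /mxinner -mxtrace_tr trmx_mul trmxK. Qed.

Lemma mxinnerDr m n (A B C : 'M[R]_(m, n)) :
  mxinner A (B + C) = mxinner A B + mxinner A C.
Proof. by rewrite /mxinner mulmxDr linearD. Qed.

Lemma mxinnerZr m n a (A B : 'M[R]_(m, n)) :
  mxinner A (a *: B) = a * mxinner A B.
Proof. by rewrite /mxinner -scalemxAr linearZ. Qed.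

Lemma mxinnerBr m n (A B C : 'M[R]_(m, n)) :
  mxinner A (B - C) = mxinner A B - mxinner A C.
Proof. by rewrite -scaleN1r mxinnerDr mxinnerZr mulN1r. Qed.

Lemma mxinner_sumr m n I (r : seq I) (F : I -> 'M[R]_(m, n)) A :
  mxinner A (\sum_(i <- r) F i) = \sum_(i <- r) mxinner A (F i).
Proof. by rewrite /mxinner mulmx_sumr linear_sum. Qed.

Lemma mxinnerDl m n (A B C : 'M[R]_(m, n)) :
  mxinner (A + B) C = mxinner A C + mxinner B C.
Proof. by rewrite mxinnerC mxinnerDr !(mxinnerC C). Qed.

Lemma mxinnerZl m n a (A B : 'M[R]_(m, n)) :
  mxinner (a *: A) B = a * mxinner A B.
Proof. by rewrite mxinnerC mxinnerZr mxinnerC. Qed.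

Lemma mxinnerBl m n (A B C : 'M[R]_(m, n)) :
  mxinner (A - B) C = mxinner A C - mxinner B C.
Proof. by rewrite mxinnerC mxinnerBr !(mxinnerC C). Qed.

Lemma mxinner0r m n (A : 'M[R]_(m, n)) : mxinner A 0 = 0.
Proof. by rewrite -(scale0r 0) mxinnerZr mul0r. Qed.

Lemma mxinner_mull m n p (A : 'M[R]_(m, n)) (B : 'M[R]_(n, p)) C :
  mxinner (A *m B) C = mxinner B (A^T *m C).
Proof. by rewrite /mxinner trmx_mul mulmxA. Qed.

Lemma mxinner_mulr m n p (A : 'M[R]_(m, n)) (B : 'M[R]_(n, p)) C :
  mxinner (A *m B) C = mxinner A (C *m B^T).
Proof. by rewrite /mxinner trmx_mul -mulmxA mxtrace_mulC mulmxA. Qed.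

Lemma mxinner_tr m n (A B : 'M[R]_(m, n)) : mxinner A^T B^T = mxinner A B.
Proof. by rewrite /mxinner -trmx_mul mxtrace_tr mxtrace_mulC. Qed.

Lemma mxinner_ge0 m n (A : 'M[R]_(m, n)) : 0 <= mxinner A A.
Proof.
rewrite mxinnerE; apply: sumr_ge0 => i _; apply: sumr_ge0 => j _.
by rewrite -expr2 sqr_ge0.
Qed.

Lemma mxinner_eq0 m n (A : 'M[R]_(m, n)) : mxinner A A = 0 -> A = 0.
Proof.
rewrite mxinnerE pair_big => /= /psumr_eq0P A0.
apply/matrixP => i j; rewrite mxE; apply/eqP; rewrite -sqrf_eq0 expr2.
by rewrite (A0 _ (i, j)) // => -[k l] _; rewrite -expr2 sqr_ge0.
Qed.

Lemma frobenius_ge0 m n (A : 'M[R]_(m, n)) : 0 <= frobenius_norm A.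
Proof. exact: sqrtr_ge0. Qed.

Lemma frobenius_sqr m n (A : 'M[R]_(m, n)) :
  frobenius_norm A ^+ 2 = mxinner A A.
Proof. by rewrite sqr_sqrtr // mxinner_ge0. Qed.

Lemma frobenius_gt0 m n (A : 'M[R]_(m, n)) : A != 0 -> 0 < frobenius_norm A.
Proof.
move=> A0; rewrite sqrtr_gt0 lt_neqAle mxinner_ge0 andbT eq_sym.
by apply: contra A0 => /eqP/mxinner_eq0->.
Qed.

Lemma frobeniusZ m n a (A : 'M[R]_(m, n)) :
  0 <= a -> frobenius_norm (a *: A) = a * frobenius_norm A.
Proof.
move=> a0; rewrite /frobenius_norm mxinnerZl mxinnerZr mulrA -expr2.
by rewrite sqrtrM ?sqr_ge0 // sqrtr_sqr ger0_norm.
Qed.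

Lemma mxinner_CS m n (A B : 'M[R]_(m, n)) :
  mxinner A B <= frobenius_norm A * frobenius_norm B.
Proof.
have [->|A0] := eqVneq A 0.
  by rewrite mxinnerC mxinner0r mulr_ge0 ?frobenius_ge0.
have [->|B0] := eqVneq B 0; first by rewrite mxinner0r mulr_ge0 ?frobenius_ge0.
have a0 := frobenius_gt0 A0; have b0 := frobenius_gt0 B0.
(* In the notation introduced below, this square expands to 2ab(ab - c), and ab > 0. *)
have := mxinner_ge0 (frobenius_norm B *: A - frobenius_norm A *: B).
rewrite !(mxinnerBl, mxinnerBr, mxinnerZl, mxinnerZr) -!frobenius_sqr.
rewrite (mxinnerC B A); move: a0 b0.
set a := frobenius_norm A; set b := frobenius_norm B; set c := mxinner A B.
move=> a0 b0 h; rewrite -(ler_pM2l (mulr_gt0 a0 b0)); nra.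
Qed.

(** Each entry of the product is an inner product of a row of [A] with a column of [B];
    Cauchy-Schwarz applies entrywise, and the squared bounds sum to the product of the squared
    norms. *)
Lemma frobenius_mulmx m n p (A : 'M[R]_(m, n)) (B : 'M[R]_(n, p)) :
  frobenius_norm (A *m B) <= frobenius_norm A * frobenius_norm B.
Proof.
rewrite -(ler_pXn2r (_ : 0 < 2)%N) ?nnegrE ?mulr_ge0 ?frobenius_ge0 //.
rewrite exprMn !frobenius_sqr !mxinnerE.
have -> : \sum_i \sum_j B i j * B i j = \sum_j \sum_i B i j * B i j.
  exact: exchange_big.
rewrite mulr_suml; apply: ler_sum => i _; rewrite mulr_sumr.
apply: ler_sum => j _.
have -> : \sum_k A i k * A i k = frobenius_norm (row i A) ^+ 2.
  rewrite frobenius_sqr mxinnerE big_ord1.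
  by apply: eq_bigr => k _; rewrite !mxE.
have -> : \sum_k B k j * B k j = frobenius_norm (col j B)^T ^+ 2.
  rewrite frobenius_sqr mxinnerE big_ord1.
  by apply: eq_bigr => k _; rewrite !mxE.
have ABE : (A *m B) i j = mxinner (row i A) (col j B)^T.
  by rewrite mxE mxinnerE big_ord1; apply: eq_bigr => k _; rewrite !mxE.
rewrite -expr2 -exprMn -real_normK ?num_real //.
rewrite ler_pXn2r ?nnegrE ?normr_ge0 ?mulr_ge0 ?frobenius_ge0 //.
rewrite ler_norml ABE mxinner_CS andbT lerNl -mulN1r -mxinnerZl.
apply: (le_trans (mxinner_CS _ _)).
by rewrite /frobenius_norm mxinnerZl mxinnerZr !mulN1r opprK.
Qed.

(** Pointwise form of an operator-norm bound, which spares later arguments the supremum in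
    [operator_norm]. *)
Definition op_bounded (c : R) m n (M : 'M[R]_(m, n)) : Prop :=
  forall x : 'cV[R]_n, frobenius_norm (M *m x) <= c * frobenius_norm x.

Lemma op_bounded_operator_norm m n (M : 'M[R]_(m, n)) :
  op_bounded (operator_norm M) M.
Proof.
move=> x; have [->|x0] := eqVneq x 0.
  by rewrite mulmx0 /frobenius_norm !mxinner0r sqrtr0 mulr0.
have nx := frobenius_gt0 x0.
rewrite -ler_pdivrMr // mulrC -frobeniusZ ?invr_ge0 ?(ltW nx) //.
rewrite scalemxAr; apply: ub_le_sup; last first.
  exists ((frobenius_norm x)^-1 *: x) => //=.
  by rewrite frobeniusZ ?invr_ge0 ?(ltW nx) // mulVf // gt_eqF.
(* The set under the supremum must be bounded above for [sup] to dominate its elements; the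
   Frobenius norm is a bound. *)
exists (frobenius_norm M) => _ [y /= y1 <-].
by rewrite (le_trans (frobenius_mulmx _ _)) // ler_piMr ?frobenius_ge0.
Qed.

Lemma op_bounded_ge c c' m n (M : 'M[R]_(m, n)) :
  c <= c' -> op_bounded c M -> op_bounded c' M.
Proof.
by move=> cc' Mc x; rewrite (le_trans (Mc x)) // ler_wpM2r ?frobenius_ge0.
Qed.

(** |M^T x|^2 = <x, M M^T x> <= |x| c |M^T x|, and a nonzero |M^T x| cancels. *)
Lemma op_bounded_tr c m n (M : 'M[R]_(m, n)) :
  0 <= c -> op_bounded c M -> op_bounded c M^T.
Proof.
move=> c0 Mc x; have [->|Mx0] := eqVneq (M^T *m x) 0.
  by rewrite {1}/frobenius_norm mxinner0r sqrtr0 mulr_ge0 ?frobenius_ge0.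
have nMx := frobenius_gt0 Mx0; rewrite -(ler_pM2r nMx) -expr2.
rewrite frobenius_sqr mxinner_mull trmxK (le_trans (mxinner_CS _ _)) //.
by rewrite [leRHS]mulrAC mulrC ler_wpM2r ?frobenius_ge0.
Qed.

Lemma frobeniusN m n (A : 'M[R]_(m, n)) :
  frobenius_norm (- A) = frobenius_norm A.
Proof.
by rewrite /frobenius_norm -scaleN1r mxinnerZl mxinnerZr !mulN1r opprK.
Qed.

Lemma op_boundedN c m n (M : 'M[R]_(m, n)) :
  op_bounded c M -> op_bounded c (- M).
Proof. by move=> Mc x; rewrite mulNmx frobeniusN. Qed.

Lemma mxinnerNl m n (A B : 'M[R]_(m, n)) : mxinner (- A) B = - mxinner A B.
Proof. by rewrite -scaleN1r mxinnerZl mulN1r. Qed.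

End FrobeniusInner.

(** * Orthogonal projectors built from matrices with orthonormal rows *)

Section Projections.
Context {R : realType} (r n : nat) (U : 'M[R]_(r, n)).
Hypothesis Uorth : U *m U^T = 1%:M.

Let Q : 'M[R]_n := 1%:M - U^T *m U.

(** Turns the abstract [proj_mx] into a matrix formula on which products can be computed. *)
Lemma orthogonal_projE : orthogonal_proj (orthogonal_compl U) = Q.
Proof.
rewrite /orthogonal_proj; set K := orthogonal_compl U.
have QU : Q *m U^T = 0 by rewrite mulmxBl mul1mx -mulmxA Uorth mulmx1 subrr.
(* A row vector in both spaces is orthogonal to itself. *)
have cap0 : (<<K>> :&: orthogonal_compl K)%MS = 0.
  apply/eqP; rewrite -submx0; apply/row_subP => i.
  set x := row i _; have := row_sub i (<<K>> :&: orthogonal_compl K)%MS.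
  rewrite -/x sub_capmx genmxE => /andP[/submxP[y xE] /sub_kermxP xK].
  suff /mxinner_eq0/(congr1 trmx) : mxinner x^T x^T = 0.
    by rewrite trmxK trmx0 => ->; exact: sub0mx.
  by rewrite /mxinner trmxK {2}xE trmx_mul mulmxA xK mul0mx linear0.
(* Split the identity as Q + U^T U: the projector fixes the rows of Q and kills those of U. *)
rewrite -[LHS]mul1mx -[1%:M](subrK (U^T *m U)) mulmxDl -mulmxA.
rewrite (proj_mx_id cap0) ?genmxE; last exact/sub_kermxP.
rewrite (proj_mx_0 cap0) ?mulmx0 ?addr0 //; apply/sub_kermxP.
by apply: trmx_inj; rewrite trmx_mul trmxK trmx0; exact: mulmx_ker.
Qed.

Lemma orthogonal_complement_tr : Q^T = Q.
Proof. by rewrite linearB /= trmx1 trmx_mul trmxK. Qed.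

Lemma mul_orthogonal_complement : U *m Q = 0.
Proof. by rewrite mulmxBr mulmx1 mulmxA Uorth mul1mx subrr. Qed.

Lemma mul_orthogonal_complement_tr : Q *m U^T = 0.
Proof. by rewrite mulmxBl mul1mx -mulmxA Uorth mulmx1 subrr. Qed.

Lemma orthogonal_complement_idem : Q *m Q = Q.
Proof.
by rewrite mulmxBl mul1mx -mulmxA mul_orthogonal_complement mulmx0 subr0.
Qed.

Lemma mxinner_tr_orthogonal p (A B : 'M[R]_(r, p)) :
  mxinner (U^T *m A) (U^T *m B) = mxinner A B.
Proof. by rewrite mxinner_mull trmxK mulmxA Uorth mul1mx. Qed.

Lemma mxinner_pythagoras p (A : 'M[R]_(n, p)) :
  mxinner A A = mxinner (U *m A) (U *m A) + mxinner (Q *m A) (Q *m A).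
Proof.
rewrite !mxinner_mull orthogonal_complement_tr !mulmxA.
rewrite orthogonal_complement_idem -mxinnerDr -mulmxDl.
by rewrite addrC subrK mul1mx.
Qed.

Lemma mxinner_orthogonal_le p (A : 'M[R]_(n, p)) :
  mxinner (U *m A) (U *m A) <= mxinner A A.
Proof. by rewrite [leRHS]mxinner_pythagoras lerDl mxinner_ge0. Qed.

Lemma mxinner_orthogonal_complement_le p (A : 'M[R]_(n, p)) :
  mxinner (Q *m A) (Q *m A) <= mxinner A A.
Proof. by rewrite [leRHS]mxinner_pythagoras lerDr mxinner_ge0. Qed.

Lemma mxinner_orthogonal_self : mxinner U U = r%:R.
Proof. by rewrite /mxinner mxtrace_mulC Uorth mxtrace1. Qed.

End Projections.

(** * Trace duality, the nuclear norm near [A], and the support decomposition *)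

Section NuclearDuality.
Context {R : realType}.

Lemma op_bounded_mxinner c m n p (M : 'M[R]_(m, n)) (A : 'M[R]_(n, p)) :
  0 <= c -> op_bounded c M ->
  mxinner (M *m A) (M *m A) <= c ^+ 2 * mxinner A A.
Proof.
move=> c0 Mc.
have sum_col q s (B : 'M[R]_(q, s)) :
    mxinner B B = \sum_j frobenius_norm (col j B) ^+ 2.
  rewrite mxinnerE exchange_big; apply: eq_bigr => j _.
  rewrite frobenius_sqr mxinnerE.
  by apply: eq_bigr => i _; rewrite big_ord1 !mxE.
rewrite !sum_col mulr_sumr; apply: ler_sum => j _.
by rewrite -exprMn colE -mulmxA -colE ler_pXn2r ?nnegrE ?mulr_ge0
  ?frobenius_ge0.
Qed.

Lemma frobenius_le m n p q (A : 'M[R]_(m, n)) (B : 'M[R]_(p, q)) :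
  (frobenius_norm A <= frobenius_norm B) = (mxinner A A <= mxinner B B).
Proof.
by rewrite -!frobenius_sqr ler_pXn2r ?nnegrE ?frobenius_ge0.
Qed.

Lemma nuclear_norm_ge0 m n (A : 'M[R]_(m, n)) : 0 <= nuclear_norm A.
Proof. by have [_ _ d0 _] := svdP A; apply: sumr_ge0 => j _; rewrite ltW. Qed.

(** By the singular value decomposition it suffices to treat u v^T with unit u and v, where <M, u
    v^T> = <M v, u> <= c. *)
Lemma nuclear_duality c m n (M A : 'M[R]_(m, n)) :
  op_bounded c M -> mxinner M A <= c * nuclear_norm A.
Proof.
move=> Mc; have [UU VV d0 AE] := svdP A.
rewrite {1}AE mxinner_sumr mulr_sumr; apply: ler_sum => j _.
rewrite mxinnerZr mulrC ler_wpM2r ?(ltW (d0 j)) //.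
have unit_row k p (W : 'M[R]_(k, p)) i :
    W *m W^T = 1%:M -> frobenius_norm (row i W)^T = 1.
  move=> /matrixP/(_ i i); rewrite !mxE eqxx /frobenius_norm => WW.
  rewrite -[RHS]sqrtr1 mxinnerE; congr Num.sqrt; apply: etrans WW.
  by apply: eq_bigr => l _; rewrite big_ord1 !mxE.
rewrite mxinnerC mxinner_mulr mxinnerC (le_trans (mxinner_CS _ _)) //.
by rewrite (unit_row _ _ _ j UU) mulr1 (le_trans (Mc _)) //
  (unit_row _ _ _ j VV) mulr1.
Qed.

(** The matrix S = sum_j u_j v_j^T, a contraction for which trace duality with [A] is an
    equality. *)
Definition svd_sign m n (A : 'M[R]_(m, n)) : 'M[R]_(m, n) :=
  (support1 A)^T *m support2 A.

Lemma support1_orth m n (A : 'M[R]_(m, n)) :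
  support1 A *m (support1 A)^T = 1%:M.
Proof. by case: (svdP A). Qed.

Lemma support2_orth m n (A : 'M[R]_(m, n)) :
  support2 A *m (support2 A)^T = 1%:M.
Proof. by case: (svdP A). Qed.

Lemma svdE m n (A : 'M[R]_(m, n)) :
  A = (support1 A)^T *m diag_mx (svd_values (svd A)) *m support2 A.
Proof. by have [_ _ _ AE] := svdP A; rewrite {1}AE svd_sumE. Qed.

Lemma mxinner_svd_sign m n (A : 'M[R]_(m, n)) :
  mxinner (svd_sign A) A = nuclear_norm A.
Proof.
rewrite {2}(svdE A) -mulmxA (mxinner_tr_orthogonal (support1_orth A)).
rewrite mxinnerC mxinner_mulr support2_orth mxinnerC /mxinner trmx1 mul1mx.
by rewrite mxtrace_diag.
Qed.

Lemma proj_off_supportE m n (A B : 'M[R]_(m, n)) :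
  proj_off_support A B =
  (1%:M - (support1 A)^T *m support1 A) *m B *m
  (1%:M - (support2 A)^T *m support2 A).
Proof.
by rewrite /proj_off_support !orthogonal_projE ?support1_orth ?support2_orth.
Qed.

Lemma mxinner_proj_off_support m n (A B C : 'M[R]_(m, n)) :
  mxinner (proj_off_support A B) C = mxinner B (proj_off_support A C).
Proof.
by rewrite !proj_off_supportE mxinner_mulr mxinner_mull
  !orthogonal_complement_tr !mulmxA.
Qed.

Lemma proj_off_support_sign m n (A : 'M[R]_(m, n)) :
  proj_off_support A (svd_sign A) = 0.
Proof.
rewrite proj_off_supportE !mulmxA.
by rewrite mul_orthogonal_complement_tr ?support1_orth // !mul0mx.
Qed.

Lemma proj_off_support_self m n (A : 'M[R]_(m, n)) : proj_off_support A A = 0.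
Proof.
rewrite proj_off_supportE [X in _ *m X *m _](svdE A) !mulmxA.
by rewrite mul_orthogonal_complement_tr ?support1_orth // !mul0mx.
Qed.

Lemma proj_off_support_idem m n (A B : 'M[R]_(m, n)) :
  proj_off_support A (proj_off_support A B) = proj_off_support A B.
Proof.
rewrite !proj_off_supportE !mulmxA orthogonal_complement_idem ?support1_orth //.
by rewrite -!mulmxA orthogonal_complement_idem ?support2_orth.
Qed.

(* Both the argument and the image split orthogonally along the support of [A]
   and its complement, and the two summands act on different parts. *)
Lemma op_bounded_sign_add m n (A W : 'M[R]_(m, n)) :
  op_bounded 1 W -> op_bounded 1 (svd_sign A + proj_off_support A W).
Proof.
move=> Wc x; rewrite mul1r frobenius_le.
have U1 := support1_orth A; have V1 := support2_orth A.
rewrite (mxinner_pythagoras U1) [leRHS](mxinner_pythagoras V1).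
rewrite proj_off_supportE /svd_sign; set Q1 := _ - _; set Q2 := _ - _.
have -> : support1 A *m (((support1 A)^T *m support2 A + Q1 *m W *m Q2) *m x)
    = support2 A *m x.
  rewrite mulmxA mulmxDr !mulmxA U1 mul1mx mul_orthogonal_complement //.
  by rewrite !mul0mx addr0.
have -> : Q1 *m (((support1 A)^T *m support2 A + Q1 *m W *m Q2) *m x)
    = Q1 *m (W *m (Q2 *m x)).
  rewrite mulmxA mulmxDr !mulmxA mul_orthogonal_complement_tr //.
  by rewrite !mul0mx add0r orthogonal_complement_idem // -!mulmxA.
rewrite lerD2l.
rewrite (le_trans (mxinner_orthogonal_complement_le U1 _)) //.
by rewrite -frobenius_le -[leRHS]mul1r.
Qed.

Lemma op_bounded_sign m n (A : 'M[R]_(m, n)) : op_bounded 1 (svd_sign A).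
Proof.
move=> x; rewrite mul1r frobenius_le -mulmxA.
by rewrite (mxinner_tr_orthogonal (support1_orth A)) mxinner_orthogonal_le //
  support2_orth.
Qed.

(** Pair A + B with the contraction S + P_A^perp(W), W being the sign of P_A^perp(B). As P_A^perp is
    self-adjoint and kills A, W sees only P_A^perp(B) and yields its nuclear norm. *)
Lemma nuclear_subgradient m n (A B : 'M[R]_(m, n)) :
  nuclear_norm A + mxinner (svd_sign A) B + nuclear_norm (proj_off_support A B)
  <= nuclear_norm (A + B).
Proof.
have := nuclear_duality (A + B)
  (op_bounded_sign_add A (op_bounded_sign (proj_off_support A B))).
rewrite mul1r mxinnerDr !(mxinnerDl _ _ A) !(mxinnerDl _ _ B).
rewrite !(mxinner_proj_off_support A (svd_sign _)).
by rewrite proj_off_support_self mxinner0r addr0 !mxinner_svd_sign addrA.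
Qed.

(** Pair the combination with its own sign and bound both terms by trace duality. *)
Lemma nuclear_convex m n (A B : 'M[R]_(m, n)) t : 0 <= t -> t <= 1 ->
  nuclear_norm ((1 - t) *: A + t *: B)
  <= (1 - t) * nuclear_norm A + t * nuclear_norm B.
Proof.
move=> t0 t1; rewrite -mxinner_svd_sign mxinnerDr !mxinnerZr.
by apply: lerD; rewrite ler_wpM2l ?subr_ge0 // -[leRHS]mul1r nuclear_duality //;
  exact: op_bounded_sign.
Qed.

(** The off-support term leaves [B] unprojected, so that an operator bound on [B] itself applies to
    it. *)
Lemma mxinner_proj_on_support m n (A B C : 'M[R]_(m, n)) :
  mxinner B C = mxinner (proj_on_support A B) (proj_on_support A C)
              + mxinner B (proj_off_support A C).
Proof.
rewrite /proj_on_support mxinnerBr !mxinnerBl !mxinner_proj_off_support.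
by rewrite proj_off_support_idem; ring.
Qed.

Lemma frobenius_svd_sign m n (A : 'M[R]_(m, n)) :
  frobenius_norm (svd_sign A) = Num.sqrt (\rank A)%:R.
Proof.
rewrite /frobenius_norm (mxinner_tr_orthogonal (support1_orth A)).
by rewrite mxinner_orthogonal_self // support2_orth.
Qed.

(** P_A(M) is the orthogonal sum of P_(S_1) M and P_(S_1^perp) M P_(S_2). Each tests M or M^T on
    rank(A) orthonormal vectors, hence the factor 2. *)
Lemma frobenius_proj_on_support c m n (A M : 'M[R]_(m, n)) :
  0 <= c -> op_bounded c M ->
  frobenius_norm (proj_on_support A M) <= c * Num.sqrt (2 * (\rank A)%:R).
Proof.
move=> c0 Mc; have U1 := support1_orth A; have V1 := support2_orth A.
rewrite -(ler_pXn2r (_ : 0 < 2)%N) ?nnegrE ?mulr_ge0 ?frobenius_ge0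
  ?sqrtr_ge0 //.
rewrite frobenius_sqr exprMn sqr_sqrtr ?mulr_ge0 // (mxinner_pythagoras U1).
have -> : support1 A *m proj_on_support A M = support1 A *m M.
  rewrite /proj_on_support proj_off_supportE mulmxBr !mulmxA.
  by rewrite mul_orthogonal_complement // !mul0mx subr0.
set Q := 1%:M - _.
have -> : Q *m proj_on_support A M = Q *m (M *m (support2 A)^T *m support2 A).
  rewrite /proj_on_support proj_off_supportE mulmxBr !mulmxA -/Q.
  by rewrite orthogonal_complement_idem // mulmxBr mulmx1 opprB addrC subrK
    !mulmxA.
have := op_bounded_mxinner (support2 A)^T c0 Mc.
rewrite mxinner_tr (mxinner_orthogonal_self V1) => h2.
have := op_bounded_mxinner (support1 A)^T c0 (op_bounded_tr c0 Mc).
rewrite -trmx_mul !mxinner_tr (mxinner_orthogonal_self U1) => h1.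
rewrite mulrDl mul1r mulrDr lerD //.
rewrite (le_trans (mxinner_orthogonal_complement_le U1 _)) //.
by rewrite mxinner_mulr -mulmxA V1 mulmx1.
Qed.

Lemma mxinner_svd_sign_on_support m n (A B : 'M[R]_(m, n)) :
  mxinner (svd_sign A) B = mxinner (svd_sign A) (proj_on_support A B).
Proof.
rewrite /proj_on_support mxinnerBr -mxinner_proj_off_support.
by rewrite proj_off_support_sign mxinnerC [X in _ - X]mxinnerC mxinner0r subr0
  mxinnerC.
Qed.

Lemma mxinner_le_split c m n (A B M : 'M[R]_(m, n)) : op_bounded c M ->
  mxinner M B <= c * (nuclear_norm (proj_on_support A B)
                      + nuclear_norm (proj_off_support A B)).
Proof.
move=> Mc; rewrite -[B in mxinner M B](subrK (proj_off_support A B)).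
by rewrite mxinnerDr mulrDr lerD // nuclear_duality.
Qed.

Lemma mxinner_le_split_rank c m n (A B M : 'M[R]_(m, n)) :
  0 <= c -> op_bounded c M ->
  mxinner M B <=
    c * Num.sqrt (2 * (\rank A)%:R) * frobenius_norm (proj_on_support A B)
    + c * nuclear_norm (proj_off_support A B).
Proof.
move=> c0 Mc; rewrite (mxinner_proj_on_support A) lerD ?nuclear_duality //.
rewrite (le_trans (mxinner_CS _ _)) // ler_wpM2r ?frobenius_ge0 //.
exact: frobenius_proj_on_support.
Qed.

End NuclearDuality.

(** * Pulling a measurable factor out of a conditional expectation *)

Section CondExpectation.
Context {d : measure_display} {T : measurableType d} {R : realType}.
Variable P : probability T R.

Lemma Rintegral_countable_partition0 (g q : T -> R) (E : (set T)^nat) :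
  trivIset setT E -> \bigcup_k E k = setT -> (forall k, measurable (E k)) ->
  P.-integrable setT (EFin \o g) ->
  (forall k, (\int[P]_(w in E k) (g w)%:E = 0)%E) ->
  P.-integrable setT (EFin \o (g \* q)) ->
  (forall k w w', E k w -> E k w' -> q w = q w') ->
  \int[P]_w (g w * q w) = 0.
Proof.
move=> tE ET mE ig gE0 igq qE; rewrite /Rintegral -ET integral_bigcup ?ET //.
(* On a nonempty cell [q] is a constant and comes out of the integral; an empty cell offers no value
   to take out but contributes nothing. *)
rewrite eseries0 // => k _ _; have [[w0 Ew0]|nE] := pselect (exists w, E k w).
  rewrite (eq_integral (fun w => (q w0)%:E * (g w)%:E)%E) => [|w]; last first.
    by rewrite inE => Ew /=; rewrite (qE k w w0) // mulrC EFinM.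
  by rewrite integralZl ?gE0 ?mule0 //; exact: integrableS ig.
rewrite (_ : E k = set0) ?integral_set0 //.
by apply/seteqP; split => // w Ew; apply: nE; exists w.
Qed.

Lemma measurable_floor_fiber c z : 0 < c ->
  measurable [set x : R | Num.floor (c * x) = z].
Proof.
move=> c0; rewrite (_ : [set x | _] = `[z%:~R / c, (z + 1)%:~R / c[%classic).
  exact: measurable_itv.
apply/seteqP; split => x /=; rewrite in_itv /= ler_pdivrMr // ltr_pdivlMr //.
  by move=> <-; rewrite mulrC floor_itv.
by rewrite mulrC => /floor_def.
Qed.

Lemma cond_expectation_orthogonal (F : set_system T) (g X : T -> R) :
  (forall E, F E -> measurable E) ->
  (forall B, measurable B -> F (X @^-1` B)) ->
  P.-integrable setT (EFin \o g) -> P.-integrable setT (EFin \o (g \* X)) ->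
  (forall E, F E -> (\int[P]_(w in E) (g w)%:E = 0)%E) ->
  \int[P]_w (g w * X w) = 0.
Proof.
(* [X] is within [1/N] of [floor (N X) / N], which is constant on each of
   countably many events of [F]. *)
move=> Fm FX ig igX gF0.
have mX : measurable_fun setT X by move=> _ B mB; rewrite setTI; exact/Fm/FX.
set I := \int[P]_w `|g w|.
suff IN N : `|\int[P]_w (g w * X w)| <= I / N.+1%:R.
  apply/eqP; rewrite -normr_eq0 eq_le normr_ge0 andbT leNgt; apply/negP => a0.
  set a := `|_| in IN a0.
  have := truncnS_gt (I / a); rewrite ltr_pdivrMr // => I_lt.
  have := IN (Num.truncn (I / a)); rewrite ler_pdivlMr // leNgt => /negP; apply.
  by rewrite mulrC.
pose fl w := Num.floor (N.+1%:R * X w).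
pose q w : R := (fl w)%:~R / N.+1%:R.
(* [pickle] numbers the integers, giving a partition indexed by the naturals. *)
pose E k := [set w | pickle (fl w) = k].
have EX k : exists2 B, measurable B & E k = X @^-1` B.
  have [[z kz]|nk] := pselect (exists z : int, pickle z = k).
    exists [set x | Num.floor (N.+1%:R * x) = z];
      first exact: measurable_floor_fiber.
    apply/seteqP; split => w /=; rewrite /E /fl /= -kz; last by move=> ->.
    exact: (pcan_inj pickleK).
  exists set0 => //; rewrite preimage_set0; apply/seteqP; split => // w /= wk.
  by apply: nk; exists (fl w).
have mE k : measurable (E k) by have [B mB ->] := EX k; exact/Fm/FX.
have ET : \bigcup_k E k = setT.
  by apply/seteqP; split => // w _; exists (pickle (fl w)).
have qE k w w' : E k w -> E k w' -> q w = q w'.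
  by rewrite /E /= => <- /(pcan_inj pickleK) fE; rewrite /q fE.
have mq : measurable_fun setT q.
  rewrite -ET; apply/(measurable_fun_bigcup _ mE) => k.
  have [[w0 Ew0]|] := pselect (exists w, E k w).
    apply: (eq_measurable_fun (cst (q w0))) => [w|]; last exact: measurable_cst.
    by rewrite inE => Ew; apply: qE Ew0 Ew.
  move=> nE; rewrite (_ : E k = set0); first exact: measurable_fun_set0.
  by apply/seteqP; split => // w Ew; apply: nE; exists w.
have Xq w : `|X w - q w| <= N.+1%:R^-1.
  have N0 : 0 < N.+1%:R :> R by [].
  have := floor_itv (N.+1%:R * X w); rewrite -/(fl w) intrD.
  rewrite -ler_pdivrMl // -ltr_pdivlMl // mulrDr mulr1 mulrC -/(q w) =>
    /andP[h1 h2].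
  by rewrite ger0_norm ?subr_ge0 // lerBlDl ltW // mulrC.
have mg : measurable_fun setT g.
  by apply/measurable_EFinP; exact: measurable_int ig.
(* Domination by |g|, since |X - q| <= 1; integrability of g q then follows by subtraction from that
   of g X. *)
have igXq : P.-integrable setT (EFin \o (g \* (X \- q))).
  apply: (le_integrable _ _ _ ig) => //.
    apply/measurable_EFinP; apply: measurable_funM => //.
    exact: measurable_funB.
  move=> w _ /=; rewrite lee_fin normrM ler_piMr // (le_trans (Xq w)) //.
  by rewrite invf_le1 ?ler1n.
have igq : P.-integrable setT (EFin \o (g \* q)).
  apply: eq_integrable (integrableB measurableT igX igXq) => // w _ /=.
  by rewrite -EFinB; congr EFin; ring.
have q0 : \int[P]_w (g w * q w) = 0.
  apply: (@Rintegral_countable_partition0 g q E) => //.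
    by move=> i j _ _ [w [<- <-]].
  by move=> k; have [B mB ->] := EX k; apply/gF0/FX.
have -> : \int[P]_w (g w * X w) = \int[P]_w (g w * (X w - q w)).
  rewrite -[RHS]addr0 -q0 -RintegralD //; apply: eq_Rintegral => w _.
  by ring.
rewrite (le_trans (le_normr_Rintegral _ igXq)) // /I mulrC -RintegralZl //.
  apply: le_Rintegral => //; first exact: integrable_norm igXq.
    exact: integrableZl (integrable_norm ig).
  by move=> w _; rewrite /= normrM mulrC ler_wpM2r.
exact: integrable_norm.
Qed.

(** Y - Z has zero integral over every event of [F], hence is orthogonal to the [F]-measurable
    [X]. *)
Lemma cond_expectation_pull_out (F : set_system T) (Y Z X : T -> R) :
  (forall E, F E -> measurable E) ->
  (forall B, measurable B -> F (X @^-1` B)) ->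
  is_cond_expectation P F Y Z ->
  P.-integrable setT (EFin \o (Y \* X)) ->
  P.-integrable setT (EFin \o (Z \* X)) ->
  fine 'E_P[Y \* X] = fine 'E_P[Z \* X].
Proof.
move=> Fm FX [iY iZ _ YZ] iYX iZX; rewrite unlock.
apply/eqP; rewrite -subr_eq0; apply/eqP.
have := @RintegralB _ _ _ P setT _ _ measurableT iYX iZX;
  rewrite /Rintegral => <-.
have iYZ : P.-integrable setT (EFin \o (Y \- Z)).
  apply: eq_integrable (integrableB measurableT iY iZ) => // w _ /=.
have := @cond_expectation_orthogonal F (Y \- Z) X Fm FX iYZ.
rewrite /Rintegral => h; rewrite -[RHS]h.
- by congr fine; apply: eq_integral => w _ /=; rewrite mulrBl.
- apply: eq_integrable (integrableB measurableT iYX iZX) => // w _ /=.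
  by rewrite mulrBl.
move=> E FE; have mE := Fm _ FE.
have iS f : P.-integrable setT (EFin \o f) -> P.-integrable E (EFin \o f).
  exact: integrableS.
have := integralB_EFin mE (iS _ iY) (iS _ iZ); rewrite YZ // subee => [<- //|].
exact: integrable_fin_num (iS _ iZ).
Qed.

End CondExpectation.

(** * The L_2(Pi) geometry and the shape of the penalized risk *)

Section DesignGeometry.
Context {d : measure_display} {T : measurableType d} {R : realType}.
Context (P : probability T R) (n m1 m2 : nat).
Context (X : 'I_n -> T -> 'M[R]_(m1, m2)) (Y : 'I_n -> T -> R).
Context (A0 : 'M[R]_(m1, m2)).
Hypothesis model : trace_regression P X Y A0.

(** Polar form of the squared L_2(Pi) norm; it is only positive semidefinite. *)
Definition L2Pi_inner (A B : 'M[R]_(m1, m2)) : R :=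
  n%:R^-1 * \sum_i \int[P]_w (mxinner A (X i w) * mxinner B (X i w)).

Let integrable_mxinnerM i A B :
  P.-integrable setT
    (EFin \o (fun w => mxinner A (X i w) * mxinner B (X i w))).
Proof.
have sq C : P.-integrable setT (EFin \o (fun w => mxinner C (X i w) ^+ 2)).
  exact: design_square_integrable model i C.
(* Polarization: ab = ((a + b)^2 - (a - b)^2) / 4. *)
have := integrableZl measurableT (4^-1 : R)
  (integrableB measurableT (sq (A + B)) (sq (A - B))).
apply: eq_integrable => // w _ /=; rewrite -EFinB -EFinM; congr EFin.
by rewrite mxinnerDl mxinnerBl; field.
Qed.

Lemma L2Pi_innerC A B : L2Pi_inner A B = L2Pi_inner B A.
Proof.
congr (_ * _); apply: eq_bigr => i _; apply: eq_Rintegral => w _.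
exact: mulrC.
Qed.

Lemma L2Pi_innerDr A B C :
  L2Pi_inner A (B + C) = L2Pi_inner A B + L2Pi_inner A C.
Proof.
rewrite /L2Pi_inner -mulrDr -big_split /=; congr (_ * _); apply: eq_bigr => i _.
by rewrite -RintegralD //; apply: eq_Rintegral => w _; rewrite mxinnerDl mulrDr.
Qed.

Lemma L2Pi_innerZr a A B : L2Pi_inner A (a *: B) = a * L2Pi_inner A B.
Proof.
rewrite /L2Pi_inner mulrCA; congr (_ * _); rewrite mulr_sumr.
apply: eq_bigr => i _; rewrite -RintegralZl //; apply: eq_Rintegral => w _.
by rewrite mxinnerZl mulrCA.
Qed.

Lemma L2Pi_innerBr A B C :
  L2Pi_inner A (B - C) = L2Pi_inner A B - L2Pi_inner A C.
Proof. by rewrite -scaleN1r L2Pi_innerDr L2Pi_innerZr mulN1r. Qed.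

Lemma L2Pi_innerBl A B C :
  L2Pi_inner (A - B) C = L2Pi_inner A C - L2Pi_inner B C.
Proof. by rewrite L2Pi_innerC L2Pi_innerBr !(L2Pi_innerC C). Qed.

Lemma L2Pi_innerZl a A B : L2Pi_inner (a *: A) B = a * L2Pi_inner A B.
Proof. by rewrite L2Pi_innerC L2Pi_innerZr L2Pi_innerC. Qed.

Lemma L2Pi_norm_sqr A : L2Pi_norm P X A ^+ 2 = L2Pi_inner A A.
Proof.
rewrite /L2Pi_norm sqr_sqrtr.
  by congr (_ * _); apply: eq_bigr => i _; rewrite unlock.
rewrite mulr_ge0 // sumr_ge0 // => i _; rewrite fine_ge0 //.
by apply: expectation_ge0 => w; exact: sqr_ge0.
Qed.

Let mean_product i : 'M[R]_(m1, m2) :=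
  \matrix_(j, k) fine 'E_P[fun w => Y i w * X i w j k].

Let mxinner_delta j k (B : 'M[R]_(m1, m2)) : mxinner (delta_mx j k) B = B j k.
Proof.
rewrite mxinnerE (bigD1 j) //= (bigD1 k) //= !big1 ?addr0 => [|i|l] /=.
- by rewrite mxE !eqxx mul1r.
- by move=> /negPf ij; rewrite big1 // => l _; rewrite mxE ij mul0r.
- by move=> /negPf lk; rewrite mxE lk andbF mul0r.
Qed.

(** The entry of X_i is measurable for the sigma-algebra of X_i, so Y_i may be replaced by its
    conditional mean; [delta_mx j k] presents the entry as an inner product. *)
Lemma mean_product_entry i j k :
  mean_product i j k =
  \int[P]_w (mxinner A0 (X i w) * mxinner (delta_mx j k) (X i w)).
Proof.
rewrite mxE.
pose Z w := \tr ((X i w)^T *m A0).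
have ZE w : Z w = mxinner A0 (X i w) by rewrite mxinnerC.
have Fm E : sigma_matrix (X i) E -> measurable E.
  apply: smallest_sub; first exact: sigma_algebra_measurable.
  move=> _ [[l p] _ [B mB <-]] /=.
  by apply: (design_measurable model).
have FX B : measurable B ->
    sigma_matrix (X i) ((fun w => X i w j k) @^-1` B).
  move=> mB; apply: sub_gen_smallest; exists (j, k) => //.
  by exists B => //; rewrite setTI.
have iZX : P.-integrable setT (EFin \o (Z \* (fun w => X i w j k))).
  apply: eq_integrable (integrable_mxinnerM i A0 (delta_mx j k)) => // w _ /=.
  by rewrite mxinner_delta -ZE.
have := cond_expectation_pull_out Fm FX (cond_mean model i)
  (product_integrable model i j k) iZX.
rewrite /= => ->; rewrite unlock; congr fine; apply: eq_integral => w _ /=.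
by rewrite mxinner_delta -ZE.
Qed.

(* The conditional mean assumption enters only through this identity: the
   averaged [E(Y_i X_i)] represents [B |-> <A0, B>_(L2 Pi)]. *)
Lemma mxinner_mean_product B :
  mxinner (n%:R^-1 *: \sum_i mean_product i) B = L2Pi_inner A0 B.
Proof.
rewrite mxinnerZl /L2Pi_inner; congr (_ * _).
rewrite mxinnerC mxinner_sumr; apply: eq_bigr => i _.
pose L C := \int[P]_w (mxinner A0 (X i w) * mxinner C (X i w)).
have LD : {morph L : C D / C + D}.
  move=> C D; rewrite /L -RintegralD //; apply: eq_Rintegral => w _.
  by rewrite mxinnerDl mulrDr.
have LZ a C : L (a *: C) = a * L C.
  rewrite /L -RintegralZl //; apply: eq_Rintegral => w _.
  by rewrite mxinnerZl mulrCA.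
have L0 : L 0 = 0 by rewrite -(scale0r 0) LZ mul0r.
rewrite -/(L B) {2}(matrix_sum_delta B) (big_morph L LD L0) mxinnerE.
apply: eq_bigr => j _; rewrite (big_morph L LD L0); apply: eq_bigr => k _.
by rewrite LZ mean_product_entry.
Qed.

(** Completing the square: Y_i X_i is its mean plus noise, and the mean supplies the cross term of
    |A - A0|^2. The subtracted constant does not depend on [A]. *)
Lemma penalized_riskE lambda w A :
  penalized_risk P X Y lambda w A =
  L2Pi_inner (A - A0) (A - A0) - L2Pi_inner A0 A0
  - 2 * mxinner (noise_matrix P X Y w) A + lambda * nuclear_norm A.
Proof.
rewrite /penalized_risk L2Pi_norm_sqr; congr (_ + _).
have -> : (2 / n%:R) *: \sum_i Y i w *: X i w
    = 2 *: (noise_matrix P X Y w + n%:R^-1 *: \sum_i mean_product i).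
  by rewrite /noise_matrix -scalerDr -big_split scalerA; congr (_ *: _);
    apply: eq_bigr => i _ /=; rewrite subrK.
rewrite mxinnerZl mxinnerDl mxinner_mean_product.
rewrite L2Pi_innerBl !L2Pi_innerBr (L2Pi_innerC A A0); ring.
Qed.

End DesignGeometry.

(** * The oracle inequality for a fixed competitor [A] *)

Section OracleInequality.
Context {d : measure_display} {T : measurableType d} {R : realType}.
Context (P : probability T R) (n m1 m2 : nat).
Context (X : 'I_n -> T -> 'M[R]_(m1, m2)) (Y : 'I_n -> T -> R).
Context (A0 : 'M[R]_(m1, m2)).
Hypothesis model : trace_regression P X Y A0.
Context (AA : {vspace 'M[R]_(m1, m2)}).

Lemma mu_at_ge0 c A : (0 <= mu_at P X AA c A)%E.
Proof.
by apply: le_ereal_inf_tmp => _ [t [t0 _] <-]; rewrite lee_fin ltW.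
Qed.

Lemma mu_at_bound c A B m : mu_at P X AA c A = m%:E -> cone AA c A B ->
  frobenius_norm (proj_on_support A B) <= m * L2Pi_norm P X B.
Proof.
move=> muE coneB; set p := frobenius_norm _; set b := L2Pi_norm P X B.
have b0 : 0 <= b by exact: sqrtr_ge0.
(* For b = 0, finiteness of the infimum supplies an admissible t, forcing p <= 0. Otherwise p / b is
   a lower bound of the admissible t. *)
have [b_eq0|b_neq0] := eqVneq b 0.
  have : (mu_at P X AA c A < +oo)%E by rewrite muE ltry.
  move=> /ereal_inf_lt[_ [t [_ /(_ B coneB) +] <-] _].
  by rewrite -/p -/b b_eq0 !mulr0.
have b_gt0 : 0 < b by rewrite lt_neqAle eq_sym b_neq0.
rewrite -ler_pdivrMr // -lee_fin -muE; apply: le_ereal_inf_tmp.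
move=> _ [t [_ tP] <-].
by rewrite lee_fin ler_pdivrMr //; exact: tP.
Qed.

Context (lambda : R) (w : T) (Ahat : 'M[R]_(m1, m2)).
Hypothesis lambda_gt0 : 0 < lambda.
Hypothesis Ahat_in : Ahat \in AA.
Hypothesis Ahat_min : forall A, A \in AA ->
  penalized_risk P X Y lambda w Ahat <= penalized_risk P X Y lambda w A.

Let M := noise_matrix P X Y w.

(* Move from the minimizer towards [A] by a step [t] and let [t] tend to [0]:
   convexity of the nuclear norm replaces subdifferential calculus. *)
Lemma minimizer_first_order A : A \in AA ->
  2 * L2Pi_inner P X (Ahat - A0) (Ahat - A)
  <= 2 * mxinner M (Ahat - A) + lambda * (nuclear_norm A - nuclear_norm Ahat).
Proof.
move=> A_in; set B := Ahat - A; set D := Ahat - A0.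
set b := L2Pi_inner P X B B.
have b0 : 0 <= b by rewrite /b -L2Pi_norm_sqr sqr_ge0.
rewrite -subr_le0; set x := _ - _.
have step t : 0 < t -> t <= 1 -> x <= t * b.
  move=> t0 t1; have C_in : (1 - t) *: Ahat + t *: A \in AA.
    by rewrite rpredD ?rpredZ.
  have := Ahat_min C_in; rewrite !(penalized_riskE model) -/M.
  have := nuclear_convex Ahat A (ltW t0) t1.
  have -> : (1 - t) *: Ahat + t *: A = Ahat - t *: B.
    by rewrite /B scalerBr scalerBl scale1r opprB addrA addrAC.
  have -> : Ahat - t *: B - A0 = D - t *: B by rewrite /D addrAC.
  rewrite !(L2Pi_innerBl model D, L2Pi_innerBr model _ D, L2Pi_innerZr model,
    L2Pi_innerZl model) mxinnerBr mxinnerZr (L2Pi_innerC P X B D) -/b -/D.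
  move=> /(ler_wpM2l (ltW lambda_gt0)) h1 h2.
  rewrite -(ler_pM2l t0) /x; lra.
rewrite leNgt; apply/negP => x0.
have s0 : 0 < x + b + 1 by rewrite ltr_wpDl // addr_ge0 // ltW.
(* This step lies in (0, 1] and makes t b < x, a contradiction. *)
have := step (x / (x + b + 1)) (divr_gt0 x0 s0).
rewrite ler_pdivrMr // mul1r -addrA lerDl addr_ge0 // => /(_ isT).
rewrite mulrAC ler_pdivlMr ?addrA // leNgt => /negP; apply.
by rewrite ltr_pM2l //; lra.
Qed.

Lemma oracle_basic A : A \in AA ->
  L2Pi_norm P X (Ahat - A0) ^+ 2 + L2Pi_norm P X (Ahat - A) ^+ 2
  <= L2Pi_norm P X (A - A0) ^+ 2 + 2 * mxinner M (Ahat - A)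
     - lambda * mxinner (svd_sign A) (Ahat - A)
     - lambda * nuclear_norm (proj_off_support A (Ahat - A)).
Proof.
move=> A_in; have := minimizer_first_order A_in.
have := nuclear_subgradient A (Ahat - A); rewrite subrKC.
move=> /(ler_wpM2l (ltW lambda_gt0)); rewrite !L2Pi_norm_sqr.
(* Prepares 2 <D, B> = |D|^2 + |B|^2 - |D - B|^2 in L_2(Pi). *)
have -> : A - A0 = (Ahat - A0) - (Ahat - A).
  by rewrite opprB [RHS]addrC addrA subrK.
set D := Ahat - A0; set B := Ahat - A.
rewrite (L2Pi_innerBl model D B) !(L2Pi_innerBr model _ D B)
  (L2Pi_innerC P X B D).
lra.
Qed.

Hypothesis noise_bound : 3 * operator_norm M <= lambda.

Let noise_op_bounded : op_bounded (lambda / 3) M.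
Proof.
by apply: op_bounded_ge (op_bounded_operator_norm M); rewrite ler_pdivlMr //
  mulrC.
Qed.

Lemma oracle_cone A : A \in AA ->
  L2Pi_norm P X (A - A0) < L2Pi_norm P X (Ahat - A0) -> cone AA 5 A (Ahat - A).
Proof.
move=> A_in D_gt; split; first by rewrite rpredB.
have := oracle_basic A_in.
have := mxinner_le_split A (Ahat - A) noise_op_bounded.
have := nuclear_duality (proj_on_support A (Ahat - A))
  (op_boundedN (op_bounded_sign A)).
rewrite mxinnerNl -mxinner_svd_sign_on_support mul1r.
move=> /(ler_wpM2l (ltW lambda_gt0)).
have := D_gt; rewrite -(ltr_pXn2r (_ : 0 < 2)%N) ?nnegrE ?sqrtr_ge0 // => Dsq.
have := sqr_ge0 (L2Pi_norm P X (Ahat - A)).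
(* With p and q the nuclear norms on and off the support, 0 < (2/3)(p + q) + p - q, that is q <
   5p. *)
move=> h1 h2 h3 h4; rewrite -(ler_pM2l lambda_gt0); lra.
Qed.

Lemma oracle_rank A : A \in AA ->
  L2Pi_norm P X (Ahat - A0) ^+ 2 + L2Pi_norm P X (Ahat - A) ^+ 2
  <= L2Pi_norm P X (A - A0) ^+ 2 + 2 * lambda * Num.sqrt (\rank A)%:R
     * frobenius_norm (proj_on_support A (Ahat - A)).
Proof.
move=> A_in; have := oracle_basic A_in.
have l3 : 0 <= lambda / 3 by rewrite divr_ge0 // ltW.
have := mxinner_le_split_rank A (Ahat - A) l3 noise_op_bounded.
have := mxinner_CS (- svd_sign A) (proj_on_support A (Ahat - A)).
rewrite mxinnerNl -mxinner_svd_sign_on_support frobeniusN frobenius_svd_sign.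
have := nuclear_norm_ge0 (proj_off_support A (Ahat - A)).
have := frobenius_ge0 (proj_on_support A (Ahat - A)).
(* Rounding sqrt 2 up to 3/2 gives the constant 1 + 2 (1/3) (3/2) = 2. The off-support nuclear norm
   has coefficient 2/3 - 1 < 0 and drops out. *)
have : Num.sqrt (2 * (\rank A)%:R) <= 3 / 2 * Num.sqrt (\rank A)%:R :> R.
  rewrite -(ler_pXn2r (_ : 0 < 2)%N) ?nnegrE ?mulr_ge0 ?sqrtr_ge0 //.
  rewrite exprMn !sqr_sqrtr ?mulr_ge0 //; have := ler0n R (\rank A); lra.
set p := frobenius_norm _; set q := Num.sqrt (2 * _); set s := Num.sqrt _.
set N := nuclear_norm _ => qs p0 N0 h1 h2 h3.
have := ler_wpM2l (ltW lambda_gt0) h1.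
have := ler_wpM2l (ltW lambda_gt0) (ler_wpM2r p0 qs).
have := mulr_ge0 (ltW lambda_gt0) N0.
lra.
Qed.

Lemma oracle_inequality A : A \in AA ->
  ((L2Pi_norm P X (Ahat - A0) ^+ 2)%:E <=
   (L2Pi_norm P X (A - A0) ^+ 2)%:E +
   (lambda ^+ 2)%:E * mu P X AA A ^+ 2 * (\rank A)%:R%:E)%E.
Proof.
move=> A_in.
have [D_le|D_gt] := leP (L2Pi_norm P X (Ahat - A0)) (L2Pi_norm P X (A - A0)).
  rewrite (@le_trans _ _ (L2Pi_norm P X (A - A0) ^+ 2)%:E) //.
    by rewrite lee_fin ler_pXn2r ?nnegrE ?sqrtr_ge0.
  rewrite leeDl // mule_ge0 ?lee_fin // mule_ge0 ?lee_fin ?sqr_ge0 //.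
  by rewrite expe_ge0 // mu_at_ge0.
have coneB := oracle_cone A_in D_gt.
have := oracle_rank A_in; have b0 := sqr_ge0 (L2Pi_norm P X (Ahat - A)).
(* Rank zero comes first: mu may be infinite there, and the product with 0 is then 0, so the bound
   must hold without the penalty term. *)
have [->|rA] := eqVneq (\rank A) 0%N.
  rewrite sqrtr0 mulr0 mul0r addr0 mule0 adde0 lee_fin => h.
  by rewrite (le_trans _ h) // lerDl.
have := mu_at_ge0 5 A; rewrite /mu.
(* With positive rank, an infinite mu makes the right side infinite. *)
case muE : (mu_at P X AA 5 A) => [m| |//]; last first.
  rewrite expe2 mulyy gt0_muley ?lte_fin ?exprn_gt0 // gt0_mulye ?lte_fin
    ?ltr0n ?lt0n //.
  by move=> _ _; rewrite addey // leey.
rewrite lee_fin => m0 h; have mb := mu_at_bound muE coneB.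
rewrite -EFin_expe -!EFinM -EFinD lee_fin.
have : (\rank A)%:R = Num.sqrt (\rank A)%:R ^+ 2 :> R by rewrite sqr_sqrtr.
move: h mb b0; set b := L2Pi_norm P X (Ahat - A); set s := Num.sqrt _.
move=> h mb b0 ->; have s0 : 0 <= 2 * lambda * s.
  by rewrite !mulr_ge0 ?sqrtr_ge0 // ltW.
(* AM-GM: 2 lambda s m b <= (lambda m s)^2 + b^2, and b^2 cancels against the left side. *)
have := ler_wpM2l s0 mb; have := sqr_ge0 (lambda * m * s - b).
lra.
Qed.

End OracleInequality.

Theorem theorem2 (R : realType) (d : measure_display) (T : measurableType d)
    (P : probability T R) (n m1 m2 : nat) (hn : (0 < n)%N)
    (X : 'I_n -> T -> 'M[R]_(m1, m2)) (Y : 'I_n -> T -> R)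
    (A0 : 'M[R]_(m1, m2)) (hmodel : trace_regression P X Y A0)
    (AA : {vspace 'M[R]_(m1, m2)}) (lambda : R) (hlambda : 0 < lambda)
    (w : T) (Ahat : 'M[R]_(m1, m2)) (hAhat : Ahat \in AA)
    (hmin : forall A, A \in AA ->
       penalized_risk P X Y lambda w Ahat <= penalized_risk P X Y lambda w A)
    (hnoise : 3 * operator_norm (noise_matrix P X Y w) <= lambda) :
  ((L2Pi_norm P X (Ahat - A0) ^+ 2)%:E <=
   ereal_inf [set (L2Pi_norm P X (A - A0) ^+ 2)%:E +
                  (lambda ^+ 2)%:E * mu P X AA A ^+ 2 * (\rank A)%:R%:E
             | A in [set A | A \in AA]])%E.
Proof.
apply: le_ereal_inf_tmp => _ [A A_in <-].
exact (oracle_inequality hmodel hlambda hAhat hmin hnoise A_in).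
Qed.
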